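(* The hypoplactic monoid $\mathrm{hypo}(\mathcal{C}_2)$ satisfies the identity $xyxyxy=xyyxxy$; that is, $uvuvuv\ \ddot{\sim}\ uvvuuv$ for all $u,v\in C_2^*$.
   Context: $|w|_a$ denotes the number of occurrences of the letter $a$ in the word $w$. Let $C_2=\{1<2<\bar2<\bar1\}$ and $C_2^*$ the free monoid over it; the symbols $3$ and $\bar3$ never occur. For $i\in\{1,2\}$, $w$ has an $i$-inversion if $w=w_1xw_2yw_3$ with $x\in\{i,\overline{i+1}\}$, $y\in\{i+1,\bar i\}$. Quasi-crystal structure on $C_2^*$: $\mathrm{wt}(w)=(|w|_1-|w|_{\bar1},|w|_2-|w|_{\bar2})$. For $i\in\{1,2\}$: if $w$ has an $i$-inversion then $\ddot{\varepsilon}_i(w)=\ddot{\varphi}_i(w)=+\infty$ and $\ddot{e}_i(w),\ddot{f}_i(w)$ are undefined; otherwise $\ddot{\varepsilon}_i(w)=|w|_{i+1}+|w|_{\bar i}$, $\ddot{\varphi}_i(w)=|w|_i+|w|_{\overline{i+1}}$; $\ddot{e}_i(w)$ is defined iff $\ddot{\varepsilon}_i(w)>0$ and is obtained by replacing the right-most letter of $w$ in $\{i+1,\bar i\}$ by its image ($\ddot{e}_1:2\mapsto1,\bar1\mapsto\bar2$; $\ddot{e}_2:\bar2\mapsto2$); $\ddot{f}_i(w)$ is defined iff $\ddot{\varphi}_i(w)>0$ and is obtained by replacing the left-most letter of $w$ in $\{i,\overline{i+1}\}$ by its image ($\ddot{f}_1:1\mapsto2,\bar2\mapsto\bar1$;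 $\ddot{f}_2:2\mapsto\bar2$). The connected component $C_2^*(w)$ is the set of words obtained from $w$ by finitely many (defined) applications of these operators. Hypoplactic congruence: $u\ddot{\sim}v$ iff there is a bijection $\psi:C_2^*(u)\to C_2^*(v)$ with $\psi(u)=v$ preserving $\mathrm{wt},\ddot{\varepsilon}_i,\ddot{\varphi}_i$ and such that $\ddot{e}_i(\psi(x))$ is defined iff $\ddot{e}_i(x)$ is (then $\psi(\ddot{e}_i(x))=\ddot{e}_i(\psi(x))$), likewise for $\ddot{f}_i$. It is a monoid congruence; $\mathrm{hypo}(\mathcal{C}_2)=C_2^*/\ddot{\sim}$. A monoid satisfies an identity $s=t$ in variables $X$ if every monoid homomorphism from $X^*$ identifies $s$ and $t$. *)

(* Defs.v *)
From HB Require Import structures.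
From mathcomp Require Import all_boot ssralg ssrint.
From mathcomp Require Import boolp classical_sets functions.

Set Implicit Arguments.
Unset Strict Implicit.
Unset Printing Implicit Defensive.

(* Constructors are listed in the order 1 < 2 < \bar 2 < \bar 1 of C_2. *)
Inductive letter := L1 | L2 | L2bar | L1bar.

Definition nat_of_letter (x : letter) : nat :=
  match x with L1 => 0 | L2 => 1 | L2bar => 2 | L1bar => 3 end.
Definition letter_of_nat (k : nat) : letter := nth L1 [:: L1; L2; L2bar; L1bar] k.
Lemma nat_of_letterK : cancel nat_of_letter letter_of_nat.
Proof. by case. Qed.
HB.instance Definition _ := Countable.copy letter (can_type nat_of_letterK).

Notation word := (seq letter).

Inductive index := I1 | I2.

(* The letters in {i, \overline{i+1}}; as \bar 3 is not in C_2, this is {2}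
   for i = 2. *)
Definition plus_letter (i : index) : pred letter :=
  match i with I1 => pred2 L1 L2bar | I2 => pred1 L2 end.

(* The letters in {i+1, \bar i}; as 3 is not in C_2, this is {\bar 2}
   for i = 2. *)
Definition minus_letter (i : index) : pred letter :=
  match i with I1 => pred2 L2 L1bar | I2 => pred1 L2bar end.

(* Only used on letters satisfying [minus_letter i]. *)
Definition e_letter (i : index) (x : letter) : letter :=
  match i, x with
  | I1, L2 => L1 | I1, L1bar => L2bar
  | I2, L2bar => L2
  | _, _ => x
  end.

(* Only used on letters satisfying [plus_letter i]. *)
Definition f_letter (i : index) (x : letter) : letter :=
  match i, x with
  | I1, L1 => L2 | I1, L2bar => L1bar
  | I2, L2 => L2bar
  | _, _ => x
  end.

Fixpoint has_inversion (i : index) (w : word) : bool :=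
  if w is x :: w' then
    (plus_letter i x && has (minus_letter i) w') || has_inversion i w'
  else false.

Lemma has_inversionP i w :
  reflect (exists w1 x w2 y w3,
             [/\ w = w1 ++ x :: w2 ++ y :: w3, plus_letter i x & minus_letter i y])
          (has_inversion i w).
Proof.
apply: (iffP idP) => [|[w1 [x [w2 [y [w3 [-> px my]]]]]]]; last first.
  elim: w1 => [|z w1 IH] /=; last by rewrite IH orbT.
  by rewrite px has_cat /= my orbT.
elim: w => [//|z w IH] /= /orP[/andP[pz /split_find]|/IH].
  by case=> y w2 w3 my _; exists [::], z, w2, y, w3; rewrite cat_rcons.
by case=> w1 [x [w2 [y [w3 [-> px my]]]]]; exists (z :: w1), x, w2, y, w3.
Qed.

Fixpoint replace_first (p : pred letter) (g : letter -> letter) (w : word) : word :=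
  if w is x :: w' then
    if p x then g x :: w' else x :: replace_first p g w'
  else [::].

Definition replace_last (p : pred letter) (g : letter -> letter) (w : word) : word :=
  rev (replace_first p g (rev w)).

Definition wt (w : word) : int * int :=
  ((count_mem L1 w)%:Z - (count_mem L1bar w)%:Z,
   (count_mem L2 w)%:Z - (count_mem L2bar w)%:Z)%R.

(* Values in nat extended with +oo, which is represented by [None]. *)
Definition qeps (i : index) (w : word) : option nat :=
  if has_inversion i w then None else Some (count (minus_letter i) w).

Definition qphi (i : index) (w : word) : option nat :=
  if has_inversion i w then None else Some (count (plus_letter i) w).

(* Partial operators; here [None] means undefined. *)
Definition qe (i : index) (w : word) : option word :=
  if qeps i w is Some n.+1 then
    Some (replace_last (minus_letter i) (e_letter i) w)
  else None.

Definition qf (i : index) (w : word) : option word :=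
  if qphi i w is Some n.+1 then
    Some (replace_first (plus_letter i) (f_letter i) w)
  else None.

Inductive component (w : word) : word -> Prop :=
  | component_refl : component w w
  | component_qe i x y : component w x -> qe i x = Some y -> component w y
  | component_qf i x y : component w x -> qf i x = Some y -> component w y.

(* The equalities with [omap psi] say that the operator is defined at [psi x]
   iff it is at [x], and that it then commutes with [psi]. *)
Record quasi_crystal_iso (u v : word) (psi : word -> word) : Prop := {
  iso_bij : set_bij (component u) (component v) psi;
  iso_wt : forall x, component u x -> wt (psi x) = wt x;
  iso_qeps : forall i x, component u x -> qeps i (psi x) = qeps i x;
  iso_qphi : forall i x, component u x -> qphi i (psi x) = qphi i x;
  iso_qe : forall i x, component u x -> qe i (psi x) = omap psi (qe i x);
  iso_qf : forall i x, component u x -> qf i (psi x) = omap psi (qf i x)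
}.

Definition hypo_equiv (u v : word) : Prop :=
  exists psi, quasi_crystal_iso u v psi /\ psi u = v.

Lemma hypo_equiv_refl u : hypo_equiv u u.
Proof.
exists id; split => //; split => // [|i x _|i x _].
- by split => // y cy; exists y.
- by case: qe.
- by case: qf.
Qed.

Lemma hypo_equiv_sym u v : hypo_equiv u v -> hypo_equiv v u.
Proof.
case=> psi [[[psi_fun psi_inj psi_surj] pw pe pp pqe pqf] psiu].
have /choice[chi chiP] :
    forall y, exists x, component v y -> component u x /\ psi x = y.
  move=> y; have [cy|] := pselect (component v y); last by exists y.
  by have [x cx <-] := psi_surj y cy; exists x.
have psiK x : component u x -> chi (psi x) = x.
  move=> cx; have [cc ec] := chiP _ (psi_fun _ cx).
  by apply: psi_inj ec; rewrite inE.
have cE P : (forall x, component u x -> P (psi x) x) ->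
    forall y, component v y -> P y (chi y).
  by move=> H y /chiP[cx e]; have := H _ cx; rewrite e.
exists chi; split; last by rewrite -psiu psiK //; exact: component_refl.
split.
- split.
  + by move=> y /chiP[].
  + move=> y z; rewrite !inE => /chiP[_ {2}<-] /chiP[_ {2}<-] e.
    by rewrite e.
  + by move=> x cx; exists (psi x); [exact: psi_fun|exact: psiK].
- by apply: (cE (fun y x => wt x = wt y)) => x /pw ->.
- by move=> i; apply: (cE (fun y x => qeps i x = qeps i y)) => x /(pe i) ->.
- by move=> i; apply: (cE (fun y x => qphi i x = qphi i y)) => x /(pp i) ->.
- move=> i; apply: (cE (fun y x => qe i x = omap chi (qe i y))) => x cx.
  rewrite pqe //.
  by case E: (qe i x) => [z|] //=; rewrite psiK //; exact: component_qe E.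
- move=> i; apply: (cE (fun y x => qf i x = omap chi (qf i y))) => x cx.
  rewrite pqf //.
  by case E: (qf i x) => [z|] //=; rewrite psiK //; exact: component_qf E.
Qed.

Lemma hypo_equiv_trans v u w : hypo_equiv u v -> hypo_equiv v w -> hypo_equiv u w.
Proof.
case=> psi [[[psi_fun psi_inj psi_surj] pw pe pp pqe pqf] psiu].
case=> chi [[cb cw ce cp cqe cqf] chiv].
have pc x : component u x -> component v (psi x) by exact: psi_fun.
exists (chi \o psi); split; last by rewrite /= psiu.
split.
- by apply: set_bij_comp cb; split.
- by move=> x cx /=; rewrite cw ?pw //; exact: pc.
- by move=> i x cx /=; rewrite ce ?pe //; exact: pc.
- by move=> i x cx /=; rewrite cp ?pp //; exact: pc.
- by move=> i x cx /=; rewrite cqe ?pqe //; [case: qe|exact: pc].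
- by move=> i x cx /=; rewrite cqf ?pqf //; [case: qf|exact: pc].
Qed.

Lemma has_inversionE i w : has_inversion i w = (qeps i w == None).
Proof. by rewrite /qeps; case: has_inversion. Qed.

Lemma has_inversion_plus i w : has_inversion i w -> has (plus_letter i) w.
Proof. by elim: w => //= x w IH /orP[/andP[->]|/IH ->] //; rewrite orbT. Qed.

Lemma has_inversion_minus i w : has_inversion i w -> has (minus_letter i) w.
Proof. by elim: w => //= x w IH /orP[/andP[_ ->]|/IH ->] //; rewrite orbT. Qed.

Lemma has_minusE i w :
  has (minus_letter i) w = (if qeps i w is Some n then 0 < n else true).
Proof.
rewrite /qeps; case: (boolP (has_inversion i w)) => [/has_inversion_minus //|_].
by rewrite has_count.
Qed.

Lemma has_plusE i w :
  has (plus_letter i) w = (if qphi i w is Some n then 0 < n else true).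
Proof.
rewrite /qphi; case: (boolP (has_inversion i w)) => [/has_inversion_plus //|_].
by rewrite has_count.
Qed.

Lemma has_inversion_cat i u v : has_inversion i (u ++ v) =
  [|| has_inversion i u, has_inversion i v
    | has (plus_letter i) u && has (minus_letter i) v].
Proof.
elim: u => [|x u IH] /=; first by rewrite orbF.
rewrite IH has_cat; move: (plus_letter i x) (has_inversion i u) (has_inversion i v).
move: (has (plus_letter i) u) (has (minus_letter i) u) (has (minus_letter i) v).
by do 6!case.
Qed.

Lemma replace_first_cat p g u v : replace_first p g (u ++ v) =
  if has p u then replace_first p g u ++ v else u ++ replace_first p g v.
Proof. by elim: u => //= x u ->; case: (p x) => //=; case: (has p u). Qed.

Lemma replace_last_cat p g u v : replace_last p g (u ++ v) =
  if has p v then u ++ replace_last p g v else replace_last p g u ++ v.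
Proof.
rewrite /replace_last rev_cat replace_first_cat has_rev.
by case: (has p v); rewrite rev_cat !revK.
Qed.

Lemma size_replace_first p g w : size (replace_first p g w) = size w.
Proof. by elim: w => //= x w IH; case: (p x) => //=; rewrite IH. Qed.

Lemma size_replace_last p g w : size (replace_last p g w) = size w.
Proof. by rewrite /replace_last size_rev size_replace_first size_rev. Qed.

Lemma qeE i w : qe i w =
  if ~~ has_inversion i w && has (minus_letter i) w
  then Some (replace_last (minus_letter i) (e_letter i) w) else None.
Proof. by rewrite /qe /qeps has_count; case: has_inversion => //; case: count. Qed.

Lemma qfE i w : qf i w =
  if ~~ has_inversion i w && has (plus_letter i) w
  then Some (replace_first (plus_letter i) (f_letter i) w) else None.
Proof. by rewrite /qf /qphi has_count; case: has_inversion => //; case: count. Qed.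

Lemma qe_cat i u v : qe i (u ++ v) =
  if has_inversion i (u ++ v) then None
  else if has (minus_letter i) v then omap (cat u) (qe i v)
  else omap (cat^~ v) (qe i u).
Proof.
rewrite !qeE has_cat replace_last_cat has_inversion_cat.
case: (has_inversion i u) => //=; case: (has_inversion i v) => //=.
case: (has (minus_letter i) v) => /=; rewrite ?andbF ?orbT ?orbF /=.
  by case: (has (plus_letter i) u).
by case: (has (minus_letter i) u).
Qed.

Lemma qf_cat i u v : qf i (u ++ v) =
  if has_inversion i (u ++ v) then None
  else if has (plus_letter i) u then omap (cat^~ v) (qf i u)
  else omap (cat u) (qf i v).
Proof.
rewrite !qfE has_cat replace_first_cat has_inversion_cat.
case: (has_inversion i u) => //=; case: (has_inversion i v) => //=.
case: (has (plus_letter i) u) => /=.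
  by case: (has (minus_letter i) v).
by case: (has (plus_letter i) v).
Qed.

Lemma size_component w x : component w x -> size x = size w.
Proof.
elim=> // i y z _ <-; rewrite ?qeE ?qfE; case: ifP => // _ [<-].
  exact: size_replace_last.
exact: size_replace_first.
Qed.

Lemma component_cat u v w : component (u ++ v) w ->
  exists a b, [/\ w = a ++ b, component u a & component v b].
Proof.
elim=> [|i x y _ [a [b [-> ca cb]]]|i x y _ [a [b [-> ca cb]]]].
- by exists u, v; split => //; exact: component_refl.
- rewrite qe_cat; case: ifP => // _; case: ifP => _.
    case E: (qe i b) => [b'|] //= [<-]; exists a, b'; split => //.
    exact: component_qe E.
  case E: (qe i a) => [a'|] //= [<-]; exists a', b; split => //.
  exact: component_qe E.
- rewrite qf_cat; case: ifP => // _; case: ifP => _.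
    case E: (qf i a) => [a'|] //= [<-]; exists a', b; split => //.
    exact: component_qf E.
  case E: (qf i b) => [b'|] //= [<-]; exists a, b'; split => //.
  exact: component_qf E.
Qed.

Lemma wt_cat u v : wt (u ++ v) = ((wt u).1 + (wt v).1, (wt u).2 + (wt v).2)%R.
Proof. by rewrite /wt !count_cat !PoszD /= !GRing.opprD; congr pair;
  rewrite GRing.addrACA. Qed.

Lemma hypo_equiv_cat u u' v v' :
  hypo_equiv u u' -> hypo_equiv v v' -> hypo_equiv (u ++ v) (u' ++ v').
Proof.
case=> psi [[[pf pi ps] pw pe pp pqe pqf] pu].
case=> chi [[[cf ci cs] cw ce cp cqe cqf] cv].
pose th w := psi (take (size u) w) ++ chi (drop (size u) w).
have thE a b : component u a -> th (a ++ b) = psi a ++ chi b.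
  by move=> /size_component sa; rewrite /th -sa take_size_cat ?drop_size_cat.
have minus_a i a : component u a ->
    (has (minus_letter i) (psi a) = has (minus_letter i) a) *
    (has (plus_letter i) (psi a) = has (plus_letter i) a) *
    (has_inversion i (psi a) = has_inversion i a).
  by move=> ca; rewrite !has_minusE !has_plusE !has_inversionE pe ?pp.
have minus_b i b : component v b ->
    (has (minus_letter i) (chi b) = has (minus_letter i) b) *
    (has (plus_letter i) (chi b) = has (plus_letter i) b) *
    (has_inversion i (chi b) = has_inversion i b).
  by move=> cb; rewrite !has_minusE !has_plusE !has_inversionE ce ?cp.
have inv_th i a b : component u a -> component v b ->
    has_inversion i (psi a ++ chi b) = has_inversion i (a ++ b).
  by move=> ca cb; rewrite !has_inversion_cat !minus_a ?minus_b.
have countE i a : component u a -> has_inversion i a = false ->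
    (count (minus_letter i) (psi a) = count (minus_letter i) a) *
    (count (plus_letter i) (psi a) = count (plus_letter i) a).
  move=> ca na; have := pe i _ ca; have := pp i _ ca.
  by rewrite /qeps /qphi !minus_a // na => -[->] [->].
have countE' i b : component v b -> has_inversion i b = false ->
    (count (minus_letter i) (chi b) = count (minus_letter i) b) *
    (count (plus_letter i) (chi b) = count (plus_letter i) b).
  move=> cb nb; have := ce i _ cb; have := cp i _ cb.
  by rewrite /qeps /qphi !minus_b // nb => -[->] [->].
have the i w : component (u ++ v) w -> qe i (th w) = omap th (qe i w).
  move=> /component_cat[a [b [-> ca cb]]]; rewrite thE // !qe_cat inv_th //.
  case: ifP => // _; rewrite minus_b //; case: ifP => _.
    by rewrite cqe //; case: (qe i b) => [b'|] //=; rewrite thE.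
  rewrite pqe //; case E: (qe i a) => [a'|] //=.
  by rewrite thE //; exact: component_qe E.
have thf i w : component (u ++ v) w -> qf i (th w) = omap th (qf i w).
  move=> /component_cat[a [b [-> ca cb]]]; rewrite thE // !qf_cat inv_th //.
  case: ifP => // _; rewrite minus_a //; case: ifP => _; last first.
    by rewrite cqf //; case: (qf i b) => [b'|] //=; rewrite thE.
  rewrite pqf //; case E: (qf i a) => [a'|] //=.
  by rewrite thE //; exact: component_qf E.
have thuv : th (u ++ v) = u' ++ v' by rewrite thE ?pu ?cv //; exact: component_refl.
exists th; split => //; split => //.
- split.
  + move=> w; elim=> [|i x y cx IH E|i x y cx IH E].
    * by rewrite thuv; exact: component_refl.
    * by apply: (@component_qe _ i (th x)) => //; rewrite the // E.
    * by apply: (@component_qf _ i (th x)) => //; rewrite thf // E.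
  + move=> x y; rewrite !inE => /component_cat[a [b [-> ca cb]]].
    move=> /component_cat[a' [b' [-> ca' cb']]]; rewrite !thE // => /eqP.
    rewrite eqseq_cat; last first.
      by rewrite (size_component (pf _ ca)) (size_component (pf _ ca')).
    move=> /andP[/eqP ea /eqP eb]; congr cat.
      by apply: pi ea; rewrite inE.
    by apply: ci eb; rewrite inE.
  + move=> w; elim=> [|i x y _ [z cz <-]|i x y _ [z cz <-]].
    * by exists (u ++ v) => //; exact: component_refl.
    * rewrite the //; case E: (qe i z) => [t|] //= [<-].
      by exists t => //; exact: component_qe E.
    * rewrite thf //; case E: (qf i z) => [t|] //= [<-].
      by exists t => //; exact: component_qf E.
- by move=> w /component_cat[a [b [-> ca cb]]]; rewrite thE // !wt_cat pw ?cw.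
- move=> i w /component_cat[a [b [-> ca cb]]]; rewrite thE // /qeps inv_th //.
  case: ifP => //; rewrite has_inversion_cat => /norP[/negbTE na /norP[/negbTE nb _]].
  by rewrite !count_cat countE ?countE'.
- move=> i w /component_cat[a [b [-> ca cb]]]; rewrite thE // /qphi inv_th //.
  case: ifP => //; rewrite has_inversion_cat => /norP[/negbTE na /norP[/negbTE nb _]].
  by rewrite !count_cat countE ?countE'.
Qed.

Definition hypo_rel : rel word := fun u v => `[< hypo_equiv u v >].

Lemma hypo_rel_refl : reflexive hypo_rel.
Proof. by move=> u; apply/asboolP/hypo_equiv_refl. Qed.

Lemma hypo_rel_sym : symmetric hypo_rel.
Proof. by move=> u v; apply: asbool_equiv_eq; split; exact: hypo_equiv_sym. Qed.

Lemma hypo_rel_trans : transitive hypo_rel.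
Proof.
by move=> v u w /asboolP uv /asboolP vw; apply/asboolP/(hypo_equiv_trans uv vw).
Qed.

Canonical hypo_equiv_rel :=
  EquivRel hypo_rel hypo_rel_refl hypo_rel_sym hypo_rel_trans.

Local Open Scope quotient_scope.

Definition hypoC2 := {eq_quot hypo_equiv_rel}.
HB.instance Definition _ := Choice.on hypoC2.
HB.instance Definition _ := EqQuotient.on hypoC2.

Definition hypo_class (u : word) : hypoC2 := \pi_hypoC2 u.
Definition hypo_mul (a b : hypoC2) : hypoC2 := hypo_class (repr a ++ repr b).

Lemma hypo_classP u v : hypo_class u = hypo_class v <-> hypo_equiv u v.
Proof. by split=> [/eqmodP/asboolP|uv] //; apply/eqmodP/asboolP. Qed.

Lemma hypo_classK a : hypo_class (repr a) = a.
Proof. exact: reprK. Qed.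

Lemma hypo_mulE u v : hypo_mul (hypo_class u) (hypo_class v) = hypo_class (u ++ v).
Proof. by apply/hypo_classP/hypo_equiv_cat; apply/hypo_classP/hypo_classK. Qed.

Lemma hypo_mulA : associative hypo_mul.
Proof.
move=> a b c; rewrite -[a]hypo_classK -[b]hypo_classK -[c]hypo_classK.
by rewrite !hypo_mulE catA.
Qed.

Lemma hypo_mul1 : left_id (hypo_class [::]) hypo_mul.
Proof. by move=> a; rewrite -[a]hypo_classK hypo_mulE. Qed.

Lemma hypo_mulr1 : right_id (hypo_class [::]) hypo_mul.
Proof. by move=> a; rewrite -[a]hypo_classK hypo_mulE cats0. Qed.

HB.instance Definition _ := isMonoid.Build hypoC2 hypo_mulA hypo_mul1 hypo_mulr1.

Lemma hypo_class1 : hypo_class [::] = 1%g.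
Proof. by []. Qed.

Lemma hypo_classM u v : (hypo_class u * hypo_class v)%g = hypo_class (u ++ v).
Proof. exact: hypo_mulE. Qed.

(* The free monoid over X is [seq X] under concatenation. *)
Definition satisfies_identity (M : monoidType) (X : Type) (s t : seq X) : Prop :=
  forall h : seq X -> M,
    h [::] = 1%g -> {morph h : a b / a ++ b >-> (a * b)%g} -> h s = h t.

Inductive variable := vx | vy.

(* Main.v *)
Require Import Defs.
From mathcomp Require Import all_boot.
From mathcomp Require Import classical_sets functions.

(* As u v u v u v = (uv)(uv)(uv) and u v v u u v = (uv)(vu)(uv), it is enough
   that adjacent letters x, y commute in a ++ [x; y] ++ b whenever x and y both
   occur in a and in b.  The isomorphism changes only these two letters: if
   {x, y} is not {1, \bar 1} or {2, \bar 2}, the pair runs through the chain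
     12 -f2-> 1\bar2 -f1-> 2\bar2 -f1-> 2\bar1 -f2-> \bar2\bar1
   (the shape of the 5-dimensional crystal of type C_2), while the pair obtained
   by exchange runs through
     21 -> \bar2 1 -> \bar1 1 -> \bar1 2 -> \bar1\bar2,
   and the letters present in a and b make the two words have the same
   inversions at every step. *)

(** * Words with a marked pair of adjacent letters *)

Definition pair_word (P : letter * letter) : word := [:: P.1; P.2].

(** The pair is located by its position, and words too short to have one are fixed, so that an
    involution [g] gives an involution of all words. *)
Definition map_pair_at (n : nat) (g : letter * letter -> letter * letter) (w : word) : word :=
  if drop n w is c :: d :: r then take n w ++ pair_word (g (c, d)) ++ r else w.

Lemma map_pair_at_cat g (a : word) P b :
  map_pair_at (size a) g (a ++ pair_word P ++ b) = a ++ pair_word (g P) ++ b.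
Proof.
by case: P => c d; rewrite /map_pair_at drop_size_cat //= take_size_cat.
Qed.

Lemma map_pair_atK n g : involutive g -> involutive (map_pair_at n g).
Proof.
move=> gK w; rewrite {2}/map_pair_at; case E: (drop n w) => [|c [|d r]].
- by rewrite /map_pair_at E.
- by rewrite /map_pair_at E.
have n_lt : n < size w by rewrite -subn_gt0 -size_drop E.
have sn : size (take n w) = n by rewrite size_takel // ltnW.
by rewrite -[X in map_pair_at X]sn map_pair_at_cat gK -[RHS](cat_take_drop n) E.
Qed.

Lemma has_replace_first (q p : pred letter) g w :
  (forall x, p x -> q (g x) = q x) -> has q (replace_first p g w) = has q w.
Proof.
by move=> qg; elim: w => //= x w IH; case: ifP => /= [/qg ->|_] //; rewrite IH.
Qed.

Lemma has_replace_last (q p : pred letter) g w :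
  (forall x, p x -> q (g x) = q x) -> has q (replace_last p g w) = has q w.
Proof. by move=> qg; rewrite /replace_last has_rev has_replace_first // has_rev. Qed.

(** The right-most replaceable letter lies in the last factor that has one; for [qf] the order of
    the tests is reversed. *)
Lemma qe_cat3 i (a p b : word) : qe i (a ++ p ++ b) =
  if has_inversion i (a ++ p ++ b) then None
  else if has (minus_letter i) b
    then Some (a ++ p ++ replace_last (minus_letter i) (e_letter i) b)
  else if has (minus_letter i) p
    then Some (a ++ replace_last (minus_letter i) (e_letter i) p ++ b)
  else if has (minus_letter i) a
    then Some (replace_last (minus_letter i) (e_letter i) a ++ p ++ b)
  else None.
Proof.
rewrite qeE; case: has_inversion => //=; rewrite !has_cat !replace_last_cat has_cat.
case: (has _ b); rewrite ?orbT //=; case: (has _ p); rewrite ?orbT ?orbF //=.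
Qed.

Lemma qf_cat3 i (a p b : word) : qf i (a ++ p ++ b) =
  if has_inversion i (a ++ p ++ b) then None
  else if has (plus_letter i) a
    then Some (replace_first (plus_letter i) (f_letter i) a ++ p ++ b)
  else if has (plus_letter i) p
    then Some (a ++ replace_first (plus_letter i) (f_letter i) p ++ b)
  else if has (plus_letter i) b
    then Some (a ++ p ++ replace_first (plus_letter i) (f_letter i) b)
  else None.
Proof.
rewrite qfE; case: has_inversion => //=; rewrite !has_cat !replace_first_cat.
by case: (has _ a) => //=; case: (has _ p).
Qed.

(** * Isomorphisms given by an involution that changes one pair *)

(** [I] is closed under the operators, so it holds on the whole component and stands in for it.
    Injectivity comes from [psi] being an involution, surjectivity by following a path of operators
    from [psi u]. *)
Lemma hypo_equiv_involution (I : word -> Prop) (psi : word -> word) u :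
  involutive psi -> I u ->
  (forall x, I x -> wt (psi x) = wt x) ->
  (forall i x, I x -> qeps i (psi x) = qeps i x) ->
  (forall i x, I x -> qphi i (psi x) = qphi i x) ->
  (forall i x, I x -> qe i (psi x) = omap psi (qe i x)) ->
  (forall i x, I x -> qf i (psi x) = omap psi (qf i x)) ->
  (forall i x y, I x -> qe i x = Some y -> I y) ->
  (forall i x y, I x -> qf i x = Some y -> I y) ->
  hypo_equiv u (psi u).
Proof.
move=> psiK Iu pw pe pp pqe pqf Ie If.
have cI x : component u x -> I x.
  by elim=> // i y z _ Iy; [apply: Ie | apply: If].
exists psi; split=> //; split; try by move=> *; auto.
split.
- move=> x; elim=> [|i y z cy IH E|i y z cy IH E]; first exact: component_refl.
  + by apply: (component_qe IH (i := i)); rewrite pqe ?E //; exact: cI.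
  + by apply: (component_qf IH (i := i)); rewrite pqf ?E //; exact: cI.
- by move=> x y _ _ e; rewrite -[x]psiK e psiK.
- move=> y; elim=> [|i x z _ [t ct <-]|i x z _ [t ct <-]].
  + by exists u => //; exact: component_refl.
  + rewrite pqe; last exact: cI.
    by case E: (qe i t) => [s|] //= [<-]; exists s => //; exact: component_qe E.
  + rewrite pqf; last exact: cI.
    by case E: (qf i t) => [s|] //= [<-]; exists s => //; exact: component_qf E.
Qed.

Definition e_pair (i : Defs.index) (P : letter * letter) : letter * letter :=
  if minus_letter i P.2 then (P.1, e_letter i P.2)
  else if minus_letter i P.1 then (e_letter i P.1, P.2) else P.

Definition f_pair (i : Defs.index) (P : letter * letter) : letter * letter :=
  if plus_letter i P.1 then (f_letter i P.1, P.2)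
  else if plus_letter i P.2 then (P.1, f_letter i P.2) else P.

Lemma replace_last_pair i P :
  replace_last (minus_letter i) (e_letter i) (pair_word P) = pair_word (e_pair i P).
Proof. by case: i P => [] [[] []]. Qed.

Lemma replace_first_pair i P :
  replace_first (plus_letter i) (f_letter i) (pair_word P) = pair_word (f_pair i P).
Proof. by case: i P => [] [[] []]. Qed.

Section LocalIsomorphism.

Variable g : letter * letter -> letter * letter.
Variable J : word -> letter * letter -> word -> bool.

Let e i := replace_last (minus_letter i) (e_letter i).
Let f i := replace_first (plus_letter i) (f_letter i).

Hypothesis gK : involutive g.
Hypothesis g_wt : forall a P b, J a P b -> wt (pair_word (g P)) = wt (pair_word P).
Hypothesis g_inversion : forall i a P b, J a P b ->
  has_inversion i (a ++ pair_word (g P) ++ b) = has_inversion i (a ++ pair_word P ++ b).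
(** An inversion inside the pair is one of the whole word and makes both operators undefined, so
    only pairs without inversion have to be compared. *)
Hypothesis g_local : forall i a P b, J a P b -> has_inversion i (pair_word P) = false ->
  [/\ count (minus_letter i) (pair_word (g P)) = count (minus_letter i) (pair_word P),
      count (plus_letter i) (pair_word (g P)) = count (plus_letter i) (pair_word P),
      e_pair i (g P) = g (e_pair i P) & f_pair i (g P) = g (f_pair i P)].
Hypothesis J_e : forall i a P b, J a P b ->
  has_inversion i (a ++ pair_word P ++ b) = false ->
  if has (minus_letter i) b then J a P (e i b)
  else if has (minus_letter i) (pair_word P) then J a (e_pair i P) b
  else J (e i a) P b.
Hypothesis J_f : forall i a P b, J a P b ->
  has_inversion i (a ++ pair_word P ++ b) = false ->
  if has (plus_letter i) a then J (f i a) P b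
  else if has (plus_letter i) (pair_word P) then J a (f_pair i P) b
  else J a P (f i b).

Lemma hypo_equiv_local a P b : J a P b ->
  hypo_equiv (a ++ pair_word P ++ b) (a ++ pair_word (g P) ++ b).
Proof.
move=> JaPb; rewrite -map_pair_at_cat.
(* The operators preserve the length of each factor; fixing [size a'] keeps the marked pair at the
   position where [map_pair_at (size a)] acts. *)
pose I (w : word) := exists a' P' b',
  [/\ w = a' ++ pair_word P' ++ b', size a' = size a & J a' P' b'].
have local i a' P' b' : J a' P' b' ->
    has_inversion i (a' ++ pair_word P' ++ b') = false ->
    [/\ count (minus_letter i) (pair_word (g P')) = count (minus_letter i) (pair_word P'),
        count (plus_letter i) (pair_word (g P')) = count (plus_letter i) (pair_word P'),
        e_pair i (g P') = g (e_pair i P') & f_pair i (g P') = g (f_pair i P')].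
  move=> j; rewrite has_inversion_cat => /norP[_ /norP[]].
  by rewrite has_inversion_cat => /norP[/negbTE n _] _; apply: g_local j n.
apply: (@hypo_equiv_involution I).
- exact: map_pair_atK.
- by exists a, P, b.
- move=> _ [a' [P' [b' [-> sa j]]]]; rewrite -sa map_pair_at_cat.
  by rewrite !wt_cat (g_wt _ _ _ j).
- move=> i _ [a' [P' [b' [-> sa j]]]]; rewrite -sa map_pair_at_cat /qeps g_inversion //.
  by case: ifP => // n; have [cm _ _ _] := local _ _ _ _ j n; rewrite !count_cat cm.
- move=> i _ [a' [P' [b' [-> sa j]]]]; rewrite -sa map_pair_at_cat /qphi g_inversion //.
  by case: ifP => // n; have [_ cp _ _] := local _ _ _ _ j n; rewrite !count_cat cp.
- move=> i _ [a' [P' [b' [-> sa j]]]]; rewrite -sa map_pair_at_cat !qe_cat3 g_inversion //.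
  case: ifP => // n; have [cm _ eg _] := local _ _ _ _ j n.
  rewrite !replace_last_pair eg [has _ (pair_word (g P'))]has_count cm -has_count.
  case: ifP => _; first by rewrite /= map_pair_at_cat.
  case: ifP => _; first by rewrite /= map_pair_at_cat.
  case: ifP => _ //=.
  by rewrite -(size_replace_last (minus_letter i) (e_letter i) a') map_pair_at_cat.
- move=> i _ [a' [P' [b' [-> sa j]]]]; rewrite -sa map_pair_at_cat !qf_cat3 g_inversion //.
  case: ifP => // n; have [_ cp _ fg] := local _ _ _ _ j n.
  rewrite !replace_first_pair fg [has _ (pair_word (g P'))]has_count cp -has_count.
  case: ifP => _ /=.
    by rewrite -(size_replace_first (plus_letter i) (f_letter i) a') map_pair_at_cat.
  case: ifP => _; first by rewrite /= map_pair_at_cat.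
  by case: ifP => _ //=; rewrite map_pair_at_cat.
- move=> i _ y [a' [P' [b' [-> sa j]]]]; rewrite qe_cat3 replace_last_pair.
  case: ifP => // n; have := J_e _ _ _ _ j n; rewrite -!/(e i _).
  case: ifP => _; first by move=> j' [<-]; exists a', P', (e i b').
  case: ifP => _; first by move=> j' [<-]; exists a', (e_pair i P'), b'.
  by case: ifP => _ // j' [<-]; exists (e i a'), P', b'; rewrite size_replace_last.
- move=> i _ y [a' [P' [b' [-> sa j]]]]; rewrite qf_cat3 replace_first_pair.
  case: ifP => // n; have := J_f _ _ _ _ j n; rewrite -!/(f i _).
  case: ifP => _.
    by move=> j' [<-]; exists (f i a'), P', b'; rewrite size_replace_first.
  case: ifP => _; first by move=> j' [<-]; exists a', (f_pair i P'), b'.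
  by case: ifP => _ // j' [<-]; exists a', P', (f i b').
Qed.

End LocalIsomorphism.

(** * Pairs running through the five-element chain *)

(** The two chains are matched position by position: the middle $2\bar2$ goes to $\bar1 1$, also of
    weight zero, and not to its reversal. *)
Definition chain_swap (P : letter * letter) : letter * letter :=
  match P with
  | (L1, L2) => (L2, L1) | (L2, L1) => (L1, L2)
  | (L1, L2bar) => (L2bar, L1) | (L2bar, L1) => (L1, L2bar)
  | (L2, L2bar) => (L1bar, L1) | (L1bar, L1) => (L2, L2bar)
  | (L2, L1bar) => (L1bar, L2) | (L1bar, L2) => (L2, L1bar)
  | (L2bar, L1bar) => (L1bar, L2bar) | (L1bar, L2bar) => (L2bar, L1bar)
  | _ => P
  end.

Lemma chain_swapK : involutive chain_swap.
Proof. by case=> [[] []]. Qed.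

(* The middle state is 2-inverted and its image is not, so a and b must supply
   a 2-inversion there; the other conditions are those from which this one can
   be recovered along the component. *)
Definition chain_inv (a : word) (P : letter * letter) (b : word) : bool :=
  match P with
  | (L1, L2) => has (pred1 L1) a && has (pred2 L2 L2bar) b
  | (L1, L2bar) => has (pred2 L1 L2) a && has (pred2 L2 L2bar) b
  | (L2, L2bar) => [&& ~~ has (plus_letter I1) a, has (pred1 L2) a,
                       ~~ has (minus_letter I1) b & has (pred1 L2bar) b]
  | (L2, L1bar) => has (pred2 L2 L2bar) a && has (pred2 L2bar L1bar) b
  | (L2bar, L1bar) => has (pred2 L2 L2bar) a && has (pred1 L1bar) b
  | _ => false
  end.

Lemma has_pred2 (x y : letter) w : has (pred2 x y) w = has (pred1 x) w || has (pred1 y) w.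
Proof. by rewrite -has_predU; apply: eq_has. Qed.

(** Once tests for two letters are split into tests for one, the goals are propositional in the
    truth values of [has] and [has_inversion]. *)
Ltac has_cases :=
  rewrite ?has_pred2;
  repeat match goal with
  | |- context [has_inversion ?i ?w] => case: (has_inversion i w) => //=
  | |- context [has ?p ?w] => case: (has p w) => //=
  end.

(** Inside the pair, $12$ and $\bar2\bar1$ lose a 1-inversion and $2\bar2$ loses a 2-inversion. The
    context makes up for it: a $1$ in [a] before the $2$, a $\bar1$ in [b] after the $\bar2$, or a
    $2$ in [a] with a $\bar2$ in [b]. *)
Lemma chain_inversion i a P b : chain_inv a P b ->
  has_inversion i (a ++ pair_word (chain_swap P) ++ b) =
  has_inversion i (a ++ pair_word P ++ b).
Proof.
rewrite !has_inversion_cat !has_cat.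
by case: P => [[] []] //=; case: i => /=; has_cases.
Qed.

(** $\ddot{e}_1$ moves letters within $\{1,2\}$ and within $\{\bar2,\bar1\}$, $\ddot{e}_2$ only
    within $\{2,\bar2\}$; these are the tests that [chain_inv] needs to survive. *)
Lemma has_replace_last_e w :
  (has (pred2 L1 L2) (replace_last (minus_letter I1) (e_letter I1) w) = has (pred2 L1 L2) w) *
  (has (pred2 L2bar L1bar) (replace_last (minus_letter I1) (e_letter I1) w)
     = has (pred2 L2bar L1bar) w) *
  (has (pred1 L1) (replace_last (minus_letter I2) (e_letter I2) w) = has (pred1 L1) w) *
  (has (pred1 L1bar) (replace_last (minus_letter I2) (e_letter I2) w) = has (pred1 L1bar) w) *
  (has (pred2 L2 L2bar) (replace_last (minus_letter I2) (e_letter I2) w)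
     = has (pred2 L2 L2bar) w).
Proof. by do !split; apply: has_replace_last; case. Qed.

Lemma has_replace_first_f w :
  (has (pred2 L1 L2) (replace_first (plus_letter I1) (f_letter I1) w) = has (pred2 L1 L2) w) *
  (has (pred2 L2bar L1bar) (replace_first (plus_letter I1) (f_letter I1) w)
     = has (pred2 L2bar L1bar) w) *
  (has (pred1 L1) (replace_first (plus_letter I2) (f_letter I2) w) = has (pred1 L1) w) *
  (has (pred1 L1bar) (replace_first (plus_letter I2) (f_letter I2) w) = has (pred1 L1bar) w) *
  (has (pred2 L2 L2bar) (replace_first (plus_letter I2) (f_letter I2) w)
     = has (pred2 L2 L2bar) w).
Proof. by do !split; apply: has_replace_first; case. Qed.

Lemma chain_swap_local i a P b : chain_inv a P b -> has_inversion i (pair_word P) = false ->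
  [/\ count (minus_letter i) (pair_word (chain_swap P)) = count (minus_letter i) (pair_word P),
      count (plus_letter i) (pair_word (chain_swap P)) = count (plus_letter i) (pair_word P),
      e_pair i (chain_swap P) = chain_swap (e_pair i P) &
      f_pair i (chain_swap P) = chain_swap (f_pair i P)].
Proof. by case: i P => [] [[] []]. Qed.

(** When the pair itself moves, the absence of an inversion sharpens the condition. For instance,
    $\ddot{e}_2$ turns $1\bar2$ into $12$ only if [a] has no $2$, so the letter of $\{1,2\}$ known
    to be in [a] is $1$. *)
Lemma chain_inv_e i a P b : chain_inv a P b ->
  has_inversion i (a ++ pair_word P ++ b) = false ->
  if has (minus_letter i) b
  then chain_inv a P (replace_last (minus_letter i) (e_letter i) b)
  else if has (minus_letter i) (pair_word P) then chain_inv a (e_pair i P) b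
  else chain_inv (replace_last (minus_letter i) (e_letter i) a) P b.
Proof.
rewrite !has_inversion_cat !has_cat.
by case: P => [[] []] //; case: i; rewrite /= ?has_replace_last_e; has_cases.
Qed.

Lemma chain_inv_f i a P b : chain_inv a P b ->
  has_inversion i (a ++ pair_word P ++ b) = false ->
  if has (plus_letter i) a
  then chain_inv (replace_first (plus_letter i) (f_letter i) a) P b
  else if has (plus_letter i) (pair_word P) then chain_inv a (f_pair i P) b
  else chain_inv a P (replace_first (plus_letter i) (f_letter i) b).
Proof.
rewrite !has_inversion_cat !has_cat.
by case: P => [[] []] //; case: i; rewrite /= ?has_replace_first_f; has_cases.
Qed.

Lemma hypo_equiv_chain a P b : chain_inv a P b ->
  hypo_equiv (a ++ pair_word P ++ b) (a ++ pair_word (chain_swap P) ++ b).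
Proof.
apply: (hypo_equiv_local chain_swap chain_inv chain_swapK).
- by move=> ? [[] []].
- exact: chain_inversion.
- exact: chain_swap_local.
- exact: chain_inv_e.
- exact: chain_inv_f.
Qed.

(** * The pairs of a letter and its bar *)

Definition flip (P : letter * letter) := (P.2, P.1).

(** With a $1$ in [a], the $\bar1$ of the pair closes a 1-inversion in either order, and the
    operators for $i=2$ touch neither letter. With $2$ and $\bar2$ in [a], the word has both a
    2-inversion and a 1-inversion, so no operator is defined. *)
Definition bar_inv (a : word) (P : letter * letter) (b : word) : bool :=
  match P with
  | (L1, L1bar) => has (pred1 L1) a
  | (L2, L2bar) => has (pred1 L2) a && has (pred1 L2bar) a
  | _ => false
  end.

Lemma hypo_equiv_bar a P b : bar_inv a P b ->
  hypo_equiv (a ++ pair_word P ++ b) (a ++ pair_word (flip P) ++ b).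
Proof.
apply: (hypo_equiv_local flip bar_inv).
- by case.
- by move=> ? [[] []].
- move=> i {}a {}P {}b; rewrite !has_inversion_cat !has_cat.
  by case: P => [[] []] //=; case: i => /=; has_cases.
- by case=> ? [[] []].
- move=> i {}a {}P {}b; rewrite !has_inversion_cat !has_cat.
  by case: P => [[] []] //; case: i; rewrite /= ?has_replace_last_e; has_cases.
- move=> i {}a {}P {}b; rewrite !has_inversion_cat !has_cat.
  by case: P => [[] []] //; case: i; rewrite /= ?has_replace_first_f; has_cases.
Qed.

(** * From commuting letters to commuting words and the identity *)

Lemma hypo_equiv_letters (a b : word) (x y : letter) :
  x \in a -> y \in a -> x \in b -> y \in b ->
  hypo_equiv (a ++ [:: x; y] ++ b) (a ++ [:: y; x] ++ b).
Proof.
move=> xa ya xb yb.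
have has1 z w : z \in w -> has (pred1 z) w by rewrite has_pred1.
move/has1: xa; move/has1: ya; move/has1: xb; move/has1: yb.
have chain P := @hypo_equiv_chain a P b.
have bar P := @hypo_equiv_bar a P b.
case: x; case: y => yb xb ya xa.
(* In order: equal letters, a pair of the first chain, the reversal of one, a letter followed by its
   bar, and the reversal of that. *)
all: first [ exact: hypo_equiv_refl
  | by apply: (chain (_, _)); rewrite /= ?has_pred2 ?(xa, xb, ya, yb) ?orbT
  | by apply: hypo_equiv_sym; apply: (chain (_, _)); rewrite /= ?has_pred2 ?(xa, xb, ya, yb) ?orbT
  | by apply: (bar (_, _)); rewrite /= ?(xa, xb, ya, yb)
  | by apply: hypo_equiv_sym; apply: (bar (_, _)); rewrite /= ?(xa, xb, ya, yb) ].
Qed.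

(** [x] passes the letters of [w] one at a time; each letter passed joins the left context, while
    the rest of [w] belongs to the right one. *)
Lemma hypo_equiv_letter_word (a w b : word) (x : letter) :
  {subset x :: w <= a} -> {subset x :: w <= b} ->
  hypo_equiv (a ++ (x :: w) ++ b) (a ++ (w ++ [:: x]) ++ b).
Proof.
elim: w a => [|y w IH] a sa sb; first exact: hypo_equiv_refl.
have xy z : z \in [:: x; y] -> z \in [:: x, y & w].
  by rewrite !inE => /orP[->|->]; rewrite ?orbT.
have w_sub z : z \in x :: w -> z \in [:: x, y & w].
  by rewrite !inE => /orP[->|->]; rewrite ?orbT.
apply: (@hypo_equiv_trans (a ++ [:: y; x] ++ w ++ b)).
  by apply: (@hypo_equiv_letters a (w ++ b) x y); rewrite ?mem_cat ?sa ?sb ?orbT ?xy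
     ?inE ?eqxx ?orbT.
have := IH (a ++ [:: y]); rewrite -!catA /=; apply=> z /w_sub zw.
  by rewrite mem_cat sa.
exact: sb.
Qed.

Lemma hypo_equiv_words (a u v b : word) :
  {subset u ++ v <= a} -> {subset u ++ v <= b} ->
  hypo_equiv (a ++ (u ++ v) ++ b) (a ++ (v ++ u) ++ b).
Proof.
elim: u a => [|x u IH] a sa sb; first by rewrite cats0; exact: hypo_equiv_refl.
have u_sub z : z \in u ++ v -> z \in (x :: u) ++ v by rewrite inE orbC => ->.
have v_sub z : z \in x :: v -> z \in (x :: u) ++ v.
  by rewrite !inE mem_cat => /orP[->|->]; rewrite ?orbT.
(* First [u] and [v] are exchanged with [x] counted in the left context, then [x] passes [v] with
   [u] counted in the right one. *)
apply: (@hypo_equiv_trans (a ++ (x :: v) ++ (u ++ b))).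
  have := IH (a ++ [:: x]); rewrite -!catA /=; apply=> z /u_sub zw.
    by rewrite mem_cat sa.
  exact: sb.
have := @hypo_equiv_letter_word a v (u ++ b) x; rewrite -!catA /=; apply=> z /v_sub zw.
  exact: sa.
by rewrite mem_cat sb ?orbT.
Qed.

Theorem theorem9p32 :
  satisfies_identity hypoC2 [:: vx; vy; vx; vy; vx; vy] [:: vx; vy; vy; vx; vx; vy] /\
  (forall u v : word,
     hypo_equiv (u ++ v ++ u ++ v ++ u ++ v) (u ++ v ++ v ++ u ++ u ++ v)).
Proof.
have words u v : hypo_equiv (u ++ v ++ u ++ v ++ u ++ v) (u ++ v ++ v ++ u ++ u ++ v).
  by have := @hypo_equiv_words (u ++ v) u v (u ++ v); rewrite -!catA; apply.
split=> // h h1 hM.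
(* The one-letter words generate the free monoid, so only the classes [h [:: vx]] and [h [:: vy]]
   matter; representatives of them serve as [u] and [v]. *)
have hE s : h s = (\prod_(x <- s) h [:: x])%g.
  elim: s => [|x s IH]; first by rewrite big_nil.
  by rewrite big_cons -IH -hM.
rewrite !hE !big_cons !big_nil !mulg1.
rewrite -[h [:: vx]]hypo_classK -[h [:: vy]]hypo_classK; move: (repr _) (repr _) => v u.
by have /hypo_classP := words u v; rewrite -!hypo_classM.
Qed.
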